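(* Fix $c\in I=[a,b]$ and suppose the true VC dimension $d_{VC}$ lies in $H=(1,M]$. Suppose that for all $i=1,\dots,W$ and $l=1,\dots,L$ the variables $r_{b_1,i}(n_l)$ are independent with $r_{b_1,i}(n_l)\sim N(\phi_{d_{VC}}(n_l),\sigma^2)$, so that the errors $\epsilon(n_l)=\hat\xi(n_l)-\phi_{d_{VC}}(n_l)$ satisfy $E(\epsilon(n_l))=0$. Then, on $\Phi_c(R)$ (that is, when $\phi_{\hat d_{VC}}\in\Phi_c(R)$), as $n\to\infty$, $m\to\infty$ and $W=W(n)\to\infty$ at suitable rates, for every $\delta>0$, $$P\left(\left\|\phi_{\hat d_{VC}}-\phi_{d_{VC}}\right\|_L\ge\delta\right)=\mathcal O\left(\frac1W\right).$$
   Context: Let $M\in\mathbb N$ be large, $H=(1,M]$, $I=[a,b]\subset\mathbb R$, and let design points $n_1,\dots,n_L$ be pre-specified. For $d\in H$ and $c\in I$ put $$\phi_{d,c}(n_l)=c\sqrt{\frac{d}{n_l}\log\left(\frac{2n_le}{d}\right)},$$ and, for the fixed $c$, write $\phi_d=(\phi_d(n_1),\dots,\phi_d(n_L))$ (dropping $c$), and let $\Phi_c$ be the set of all $\phi_d$, $d\in H$. The norm $\|\cdot\|_L$ is derived from the inner product $\langle f,g\rangle=\frac1L\sum_{l=1}^Lf(n_l)g(n_l)$. Choose $R>\sup_{d\in H}\|\phi_d\|_L$, and let $$\Phi_c(R)=\{\phi\in\Phi_c:\|\phi-\phi_{d_{VC}}\|_L<R\},$$ where $d_{VC}$ is the true value.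 For each design point $n_l$ one has random (bootstrap) values $r_{b_1,i}(n_l)$, $i=1,\dots,W$, and $$\hat\xi(n_l)=\frac1W\sum_{i=1}^Wr_{b_1,i}(n_l)=\phi_{d_{VC}}(n_l)+\epsilon(n_l).$$ The estimator $\hat d_{VC}$ is a value of $d\in H$ minimizing $\sum_{l=1}^L\left(\hat\xi(n_l)-\phi_d(n_l)\right)^2$. Here $n$ is the sample size, $m$ is the number of intervals used to discretize the loss, and $W$ is the number of bootstrap replicates; the only way $n$ and $m$ enter the setting is through $W=W(n)$ and through the assumed distribution of the $r_{b_1,i}(n_l)$, which is assumed to hold exactly with a common $\sigma^2$. The constant in $\mathcal O(1/W)$ may depend on $R,\sigma,\delta$. *)

(* Defs.v *)
From HB Require Import structures.
From mathcomp Require Import all_boot all_order all_algebra.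
From mathcomp Require Import all_classical all_reals all_analysis.

Set Implicit Arguments.
Unset Strict Implicit.
Unset Printing Implicit Defensive.

Import Order.TTheory GRing.Theory Num.Theory.
Import numFieldNormedType.Exports.

Local Open Scope classical_set_scope.
Local Open Scope ring_scope.

Section regression.
Context {R : realType}.

Definition dimension_set (M : nat) : set R := `]1, M%:R].

(* [phi c d x] has a nonnegative radicand exactly when d <= 2 e x (for d, x > 0);
   otherwise [Num.sqrt] returns 0. *)
Definition phi (c d x : R) : R :=
  c * Num.sqrt (d / x * ln (2 * x * expR 1 / d)).

(* A function on the design points is represented by its vector of values. *)
Definition phi_vec (L : nat) (ns : 'I_L -> R) (c d : R) : 'rV[R]_L :=
  \row_l phi c d (ns l).

Definition inner (L : nat) (f g : 'rV[R]_L) : R :=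
  L%:R^-1 * \sum_(l < L) f 0 l * g 0 l.

Definition normL (L : nat) (f : 'rV[R]_L) : R := Num.sqrt (inner f f).

Definition Phi (L : nat) (ns : 'I_L -> R) (M : nat) (c : R) : set 'rV[R]_L :=
  [set phi_vec ns c d | d in dimension_set M].

Definition Phi_ball (L : nat) (ns : 'I_L -> R) (M : nat) (c dVC rad : R) :
    set 'rV[R]_L :=
  [set f | Phi ns M c f /\ normL (f - phi_vec ns c dVC) < rad].

Definition sq_loss (L : nat) (ns : 'I_L -> R) (c : R) (xi : 'rV[R]_L) (d : R)
    : R :=
  \sum_(l < L) (xi 0 l - phi c d (ns l)) ^+ 2.

Definition minimizers (L : nat) (ns : 'I_L -> R) (M : nat) (c : R)
    (xi : 'rV[R]_L) : set R :=
  [set d | dimension_set M d /\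
    forall d', dimension_set M d' -> sq_loss ns c xi d <= sq_loss ns c xi d'].

End regression.

Section bootstrap.
Context {R : realType} {disp : measure_display} {T : measurableType disp}.
Variable P : probability T R.

Definition mutually_independent (I : finType) (X : I -> {RV P >-> R}) : Prop :=
  forall (J : {set I}) (B : I -> set R),
    (forall j, j \in J -> measurable (B j)) ->
    P (\bigcap_(j in [set` J]) X j @^-1` B j) =
    (\prod_(j in J) P (X j @^-1` B j))%E.

Definition normally_distributed (X : {RV P >-> R}) (mean sd : R) : Prop :=
  forall B : set R, measurable B -> distribution P X B = normal_prob mean sd B.

Definition xi_hat (L W : nat) (r : 'I_W -> 'I_L -> {RV P >-> R}) (w : T) :
    'rV[R]_L :=
  \row_l (W%:R^-1 * \sum_(i < W) r i l w).

Definition gaussian_bootstrap (L W : nat) (ns : 'I_L -> R) (c dVC sigma : R)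
    (r : 'I_W -> 'I_L -> {RV P >-> R}) : Prop :=
  mutually_independent (fun p : 'I_W * 'I_L => r p.1 p.2) /\
  forall i l, normally_distributed (r i l) (phi c dVC (ns l)) sigma.

(* The dimension set is open at 1, so the loss need not attain its infimum;
   the value of the estimator is constrained only where a minimizer exists. *)
Definition least_squares_estimator (L W : nat) (ns : 'I_L -> R) (M : nat)
    (c : R) (r : 'I_W -> 'I_L -> {RV P >-> R}) (dhat : {RV P >-> R}) : Prop :=
  forall w, minimizers ns M c (xi_hat r w) !=set0 ->
    minimizers ns M c (xi_hat r w) (dhat w).

(* The first conjunct says that the estimate exists: without a minimizer the
   value of [dhat] is meaningless. *)
Definition deviation_event (L W : nat) (ns : 'I_L -> R) (M : nat)
    (c dVC rad delta : R) (r : 'I_W -> 'I_L -> {RV P >-> R})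
    (dhat : {RV P >-> R}) : set T :=
  [set w | [/\ minimizers ns M c (xi_hat r w) (dhat w),
               Phi_ball ns M c dVC rad (phi_vec ns c (dhat w)) &
               delta <= normL (phi_vec ns c (dhat w) - phi_vec ns c dVC)]].

End bootstrap.

(* Main.v *)
Require Import Defs.
From HB Require Import structures.
From mathcomp Require Import all_boot all_order all_algebra.
From mathcomp Require Import all_classical all_reals all_analysis.
From mathcomp Require Import ring lra measurable_realfun.

(** The argument is the basic inequality of least squares followed by Markov's
    inequality, with C = 16 sqrt(2) sigma^2 / delta^2.

    Write phi0 for the vector of true values and eps = xi_hat - phi0 for the
    error of the averaged bootstrap values. A minimizer d of the squared loss
    does at least as well as the true dimension, and expanding the two squares
    gives |phi_d - phi0|^2 <= 4 |eps|^2 ([minimizer_error]). A deviation of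
    size delta therefore forces |eps|^2 >= delta^2 / 4, whatever the number of
    design points and the shape of the regression function.

    At a design point, eps is the mean of W pairwise independent centred normal
    variables. Independent centred variables are orthogonal in L^2
    ([independent_expectationM]: their joint law is the product law, and Fubini
    applies), so the square of their sum has expectation the sum of the
    expectations of the squares ([expectation_sqr_sum]) and E(eps^2) is of order
    sigma^2 / W ([bootstrap_mean_square_error]). For the normal law this takes
    the mean, obtained from the symmetry of the density, and a bound on the
    second central moment, obtained by comparing x^2 times the density with the
    density of a wider normal law.

    Comparing probabilities needs the deviation event to be measurable
    ([measurable_deviation_event]): a probability is constrained on measurable
    sets only. Being a minimizer is a condition on an uncountable family of
    competitors, but the loss is continuous in d, so that the rational ones
    suffice and the event becomes a countable intersection. *)

Set Implicit Arguments.
Unset Strict Implicit.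
Unset Printing Implicit Defensive.

Import Order.TTheory GRing.Theory Num.Theory.
Import numFieldNormedType.Exports.

Local Open Scope classical_set_scope.
Local Open Scope ring_scope.

(** * Moments of the normal law *)

Section square_integrable.
Local Open Scope ereal_scope.
Context {d : measure_display} {T : measurableType d} {R : realType}.
Variable P : probability T R.

Lemma Lfun2_of_integral_sqr (f : T -> R) : measurable_fun [set: T] f ->
  \int[P]_w ((f w) ^+ 2)%R%:E < +oo -> f \in Lfun P 2%:E.
Proof.
move=> mf foo; rewrite inE; apply/andP; split; rewrite inE//=.
rewrite /finite_norm unlock /Lnorm poweR_lty//.
apply: le_lt_trans foo; apply: ge0_le_integral => //=.
- apply/measurable_EFinP.
  apply/(@measurableT_comp _ _ _ _ _ _ (fun x : R => x `^ 2)%R) => //.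
  exact/measurableT_comp.
- by apply/measurable_EFinP; exact: measurable_funX.
- by move=> w _; rewrite lee_fin powR_mulrn// -normrX ger0_norm// sqr_ge0.
Qed.

End square_integrable.

Section normal_moments.
Context {R : realType}.
Local Notation mu := (@lebesgue_measure R).
Implicit Types (m s x : R) (f : R -> \bar R).

(** The normal law is defined by its values on sets; as it is dominated by the
    Lebesgue measure, integrating against it goes through its Radon-Nikodym
    derivative, which the defining integral identifies with the density almost
    everywhere. *)
Lemma ge0_integral_normal_prob m s f :
  measurable_fun [set: R] f -> (forall x, (0 <= f x)%E) ->
  (\int[normal_prob m s]_x f x = \int[mu]_x (f x * (normal_pdf m s x)%:E))%E.
Proof.
move=> mf f0.
have dom := @normal_prob_dominates R m s.
have mpdf : measurable_fun [set: R] (fun x => (normal_pdf m s x)%:E).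
  by apply/measurable_EFinP; exact: measurable_normal_pdf.
rewrite -(Radon_Nikodym_SigmaFinite.change_of_variables dom f0)//.
have irn := Radon_Nikodym_SigmaFinite.f_integrable dom.
apply: ae_eq_integral => //.
- by apply: emeasurable_funM => //; exact: measurable_int irn.
- exact: emeasurable_funM.
apply: ae_eqe_mul2l; apply: integral_ae_eq => //.
by move=> E _ mE; rewrite -Radon_Nikodym_SigmaFinite.f_integral.
Qed.

(** With u = (x - m)^2 / (4 s^2), the density at x is proportional to
    exp(-u) exp(-u) and one factor absorbs the square, as u exp(-u) <= 1. The
    remaining exp(-u) is proportional to the density with standard deviation
    sqrt(2) s, whose integral is known. This avoids computing the exact second
    moment s^2. *)
Lemma normal_second_moment_density m s x : 0 < s ->
  (x - m) ^+ 2 * normal_pdf m s x <=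
  4 * Num.sqrt 2 * s ^+ 2 * normal_pdf m (Num.sqrt 2 * s) x.
Proof.
move=> s0.
have s0' : s != 0 by rewrite gt_eqF.
have t0 : 0 < Num.sqrt 2 :> R by rewrite sqrtr_gt0.
have st0' : Num.sqrt 2 * s != 0 by rewrite mulf_neq0// gt_eqF.
rewrite (normal_pdfE _ s0') (normal_pdfE _ st0').
have -> : normal_peak s = Num.sqrt 2 * normal_peak (Num.sqrt 2 * s).
  rewrite /normal_peak exprMn sqr_sqrtr//.
  have -> : 2 * s ^+ 2 * pi *+ 2 = 2 * (s ^+ 2 * pi *+ 2) by ring.
  by rewrite sqrtrM// invfM mulrA divff ?mul1r// gt_eqF.
set q := normal_peak _.
have q0 : 0 <= q by exact: normal_peak_ge0.
set u := (x - m) ^+ 2 / (4 * s ^+ 2).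
have -> : normal_fun m s x = expR (- u) * expR (- u).
  rewrite -expRD /normal_fun /u; congr expR; field.
  by rewrite s0'.
have -> : normal_fun m (Num.sqrt 2 * s) x = expR (- u).
  rewrite /normal_fun /u exprMn sqr_sqrtr//; congr expR; field.
  by rewrite s0'.
have -> : (x - m) ^+ 2 = 4 * s ^+ 2 * u.
  by rewrite /u; field; rewrite s0'.
have u_expN_le1 : u * expR (- u) <= 1.
  rewrite expRN ler_pdivrMr ?expR_gt0// mul1r.
  by apply: le_trans (expR_ge1Dx u); rewrite lerDr.
have -> : 4 * s ^+ 2 * u * (Num.sqrt 2 * q * (expR (- u) * expR (- u))) =
    (4 * Num.sqrt 2 * s ^+ 2 * (q * expR (- u))) * (u * expR (- u)) by ring.
by rewrite ler_piMr// !mulr_ge0 ?expR_ge0 ?(ltW s0)//.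
Qed.

Lemma normal_second_moment m s : 0 < s ->
  (\int[normal_prob m s]_x ((x - m) ^+ 2)%:E <=
   (4 * Num.sqrt 2 * s ^+ 2)%:E)%E.
Proof.
move=> s0.
have mq : measurable_fun [set: R] (fun x : R => (x - m) ^+ 2).
  by apply: measurable_funX; exact: measurable_funB.
rewrite ge0_integral_normal_prob; last 2 first.
- exact/measurable_EFinP.
- by move=> x; rewrite lee_fin sqr_ge0.
under eq_integral do rewrite -EFinM.
apply: (@le_trans _ _ (\int[mu]_x
   ((4 * Num.sqrt 2 * s ^+ 2)%:E * (normal_pdf m (Num.sqrt 2 * s) x)%:E))%E).
  apply: ge0_le_integral => //.
  - by move=> x _; rewrite lee_fin mulr_ge0 ?sqr_ge0 ?normal_pdf_ge0.
  - by apply/measurable_EFinP/measurable_funM => //; exact: measurable_normal_pdf.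
  - by apply/measurable_EFinP/measurable_funM => //; exact: measurable_normal_pdf.
  - by move=> x _; rewrite -EFinM lee_fin normal_second_moment_density.
rewrite ge0_integralZl//.
- by rewrite integral_normal_pdf mule1.
- by apply/measurable_EFinP; exact: measurable_normal_pdf.
- by move=> x _; rewrite lee_fin normal_pdf_ge0.
- by rewrite lee_fin !mulr_ge0// ltW.
Qed.

(** The reflection maps half-open intervals to half-open intervals of the same
    length, and these determine the Lebesgue measure. *)
Lemma ge0_integral_reflect c f :
  measurable_fun [set: R] f -> (forall x, (0 <= f x)%E) ->
  (\int[mu]_x f (c - x)%R = \int[mu]_x f x)%E.
Proof.
move=> mf f0.
have mr : measurable_fun [set: measurableTypeR R]
   ((fun x => c - x) : _ -> measurableTypeR R).
  exact: measurable_funB.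
pose mixin := isMeasurableFun.Build _ _ _ _ _ mr.
pose X : {mfun measurableTypeR R >-> measurableTypeR R} :=
  HB.pack (fun x => c - x) mixin.
transitivity (\int[pushforward mu X]_x f x)%E.
  by rewrite ge0_integral_pushforward; [|exact: mr|exact: measurableT|
    exact: mf|by move=> x _; exact: f0].
rewrite (eq_measure_integral mu)// => A mA _; apply/esym.
apply: (@lebesgue_measure_unique R (pushforward mu X)) => //= _ [[a b]] _ <-.
rewrite /pushforward /=.
have -> : (fun x : R => c - x) @^-1` `]a, b]%classic = `[c - b, c - a[%classic.
  by apply/seteqP; split => x /=; rewrite !in_itv/=; lra.
rewrite !lebesgue_measure_itv/= !lte_fin.
have -> : (c - b < c - a) = (a < b) by lra.
by case: ifPn => // _; congr EFin; ring.
Qed.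

Lemma ge0_integral_normal_prob_reflect m s f : s != 0 ->
  measurable_fun [set: R] f -> (forall x, (0 <= f x)%E) ->
  (\int[normal_prob m s]_x f (m + m - x)%R = \int[normal_prob m s]_x f x)%E.
Proof.
move=> s0 mf f0.
have mr : measurable_fun [set: R] (fun x : R => m + m - x).
  exact: measurable_funB.
have mpdf : measurable_fun [set: R] (EFin \o normal_pdf m s).
  by apply/measurable_EFinP; exact: measurable_normal_pdf.
rewrite !ge0_integral_normal_prob//; last exact: measurableT_comp.
rewrite -[RHS](ge0_integral_reflect (m + m)); last 2 first.
- exact: emeasurable_funM.
- by move=> x; rewrite mule_ge0// lee_fin normal_pdf_ge0.
apply: eq_integral => x _; congr (_ * _%:E)%E.
rewrite !normal_pdfE// /normal_fun.
by have -> : (m + m - x - m) ^+ 2 = (x - m) ^+ 2 by ring.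
Qed.

(** Reflection about m exchanges the positive and the negative part of x - m;
    their integrals are finite by the second moment bound, so they cancel. *)
Lemma normal_mean m s : 0 < s ->
  (\int[normal_prob m s]_x (x - m)%:E = 0)%E.
Proof.
move=> s0.
pose h : R -> \bar R := fun x => (x - m)%:E.
have mh : measurable_fun [set: R] h.
  by apply/measurable_EFinP; exact: measurable_funB.
have mhN : measurable_fun [set: R] h^\-%E by exact: measurable_funeneg.
have pos_eq_neg : (\int[normal_prob m s]_x h^\+%E x =
                   \int[normal_prob m s]_x h^\-%E x)%E.
  rewrite -[RHS]ge0_integral_normal_prob_reflect ?gt_eqF//.
  apply: eq_integral => x _; rewrite funeposE funenegE /h.
  by congr (maxe _%:E _); ring.
have h_Lfun2 : (fun x => x - m) \in Lfun (normal_prob m s) 2%:E.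
  apply: Lfun2_of_integral_sqr; first exact: measurable_funB.
  by apply: le_lt_trans (normal_second_moment m s0) _; rewrite ltry.
have ih : (normal_prob m s).-integrable setT h.
  by apply/Lfun1_integrable; apply: Lfun_subset12 h_Lfun2; exact: fin_num_measure.
rewrite [LHS]integralE -/h pos_eq_neg.
by apply/subee/integrable_fin_num => //; exact: integrable_funeneg.
Qed.

End normal_moments.

Section normal_random_variable.
Local Open Scope ereal_scope.
Context {d : measure_display} {T : measurableType d} {R : realType}.
Variables (P : probability T R) (X : {RV P >-> R}) (m s : R).
Hypotheses (s0 : (0 < s)%R) (Xms : normally_distributed X m s).

(* [normal_prob] lives on [measurableTypeR R], whose measurable sets are those
   of [R] but whose display differs; [X'] is [X] with that codomain. *)
Let mX : measurable_fun [set: T] (X : T -> measurableTypeR R).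
Proof. by move=> _ B mB; exact: (@measurable_funPT _ _ _ _ X). Qed.

Let mixin := isMeasurableFun.Build _ _ _ _ _ mX.

Let X' : {mfun T >-> measurableTypeR R} :=
  HB.pack (X : T -> measurableTypeR R) mixin.

Let distributionE B : measurable B -> distribution P X' B = normal_prob m s B.
Proof. exact: Xms. Qed.

Lemma ge0_integral_normal_rv (f : R -> \bar R) :
  measurable_fun [set: R] f -> (forall x, 0 <= f x) ->
  \int[P]_w f (X w) = \int[normal_prob m s]_x f x.
Proof.
move=> mf f0; rewrite -(ge0_integral_distribution X')//.
by apply: eq_measure_integral => B mB _; exact: distributionE.
Qed.

Lemma integral_normal_rv (f : R -> \bar R) :
  measurable_fun [set: R] f -> P.-integrable [set: T] (f \o X) ->
  \int[P]_w f (X w) = \int[normal_prob m s]_x f x.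
Proof.
move=> mf intf; rewrite -(integral_distribution (X := X'))//.
by apply: eq_measure_integral => B mB _; exact: distributionE.
Qed.

Lemma normal_rv_second_moment :
  'E_P[fun w => ((X w - m) ^+ 2)%R] <= (4 * Num.sqrt 2 * s ^+ 2)%R%:E.
Proof.
rewrite unlock (ge0_integral_normal_rv (f := fun x => ((x - m) ^+ 2)%R%:E)).
- exact: normal_second_moment.
- by apply/measurable_EFinP/measurable_funX; exact: measurable_funB.
- by move=> x; rewrite lee_fin sqr_ge0.
Qed.

Lemma normal_rv_Lfun2 : (fun w => X w - m)%R \in Lfun P 2%:E.
Proof.
apply: Lfun2_of_integral_sqr; first exact: measurable_funB.
have := normal_rv_second_moment; rewrite unlock => /le_lt_trans; apply.
by rewrite ltry.
Qed.

Lemma normal_rv_mean : 'E_P[fun w => X w - m]%R = 0.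
Proof.
rewrite unlock (integral_normal_rv (f := fun x => (x - m)%R%:E)).
- exact: normal_mean.
- by apply/measurable_EFinP; exact: measurable_funB.
- apply/Lfun1_integrable; apply: Lfun_subset12 normal_rv_Lfun2.
  exact: fin_num_measure.
Qed.

End normal_random_variable.

(** * Orthogonality of independent centred variables *)

Section independence.
Local Open Scope ereal_scope.
Context {d : measure_display} {T : measurableType d} {R : realType}.
Variable P : probability T R.

(** Independence says that the joint law of (X, Y) agrees with the product of the
    marginal laws on rectangles, hence everywhere, and Fubini factors the
    integral of f(x) g(y). Square integrability of both factors is what makes
    the product integrable. *)
Lemma independent_expectationM (X Y : {RV P >-> R}) (f g : R -> R) :
  (forall A B, measurable A -> measurable B ->
    P (X @^-1` A `&` Y @^-1` B) = P (X @^-1` A) * P (Y @^-1` B)) ->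
  measurable_fun [set: R] f -> measurable_fun [set: R] g ->
  f \o X \in Lfun P 2%:E -> g \o Y \in Lfun P 2%:E ->
  'E_P[((f \o X) \* (g \o Y))%R] = 'E_P[f \o X] * 'E_P[g \o Y].
Proof.
move=> indep mf mg fX gY.
have Pfin : P setT \is a fin_num := fin_num_measure P _ measurableT.
have fX1 : P.-integrable setT (EFin \o (f \o X)).
  exact/Lfun1_integrable/(Lfun_subset12 Pfin).
have gY1 : P.-integrable setT (EFin \o (g \o Y)).
  exact/Lfun1_integrable/(Lfun_subset12 Pfin).
have fgXY : P.-integrable setT (EFin \o ((f \o X) \* (g \o Y))%R).
  exact/Lfun1_integrable/Lfun2_mul_Lfun1.
pose h (z : R * R) : \bar R := (f z.1 * g z.2)%R%:E.
pose XY w := (X w, Y w).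
have mXY : measurable_fun [set: T] XY by exact: measurable_fun_pair.
have mh : measurable_fun [set: R * R] h.
  by apply/measurable_EFinP/measurable_funM; exact: measurableT_comp.
pose mixin := isMeasurableFun.Build _ _ _ _ _ mXY.
pose RXY : {RV P >-> (R * R)%type} := HB.pack XY mixin.
pose m1 := distribution P X; pose m2 := distribution P Y.
have joint A : measurable A -> (m1 \x m2)%E A = distribution P RXY A.
  apply: product_measure_unique => A' B' mA mB.
  by rewrite /distribution /pushforward/= -indep.
have ih : (distribution P RXY).-integrable setT h.
  by apply: integrable_pushforward.
have ih2 : (m1 \x m2)%E.-integrable setT h.
  apply/integrableP; split => //.
  rewrite (eq_measure_integral (distribution P RXY)).
    by move/integrableP : ih => [].
  by move=> A mA _; exact: joint.
rewrite unlock.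
transitivity (\int[distribution P RXY]_z h z)%E.
  by rewrite integral_distribution.
rewrite -(eq_measure_integral (distribution P RXY) (m1 := m1 \x m2)); last first.
  by move=> A mA _; exact: joint.
rewrite -integral12_prod_meas1// /fubini_F /h/=.
have mfE : measurable_fun [set: R] (EFin \o f) by exact/measurable_EFinP.
have mgE : measurable_fun [set: R] (EFin \o g) by exact/measurable_EFinP.
have ifX : m1.-integrable setT (EFin \o f) by apply: integrable_pushforward.
have igY : m2.-integrable setT (EFin \o g) by apply: integrable_pushforward.
have -> : (\int[P]_w ((f \o X) w)%:E = \int[m1]_x (f x)%:E)%E.
  by rewrite (integral_distribution (f := EFin \o f)).
have -> : (\int[P]_w ((g \o Y) w)%:E = \int[m2]_x (g x)%:E)%E.
  by rewrite (integral_distribution (f := EFin \o g)).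
under eq_integral => x _.
  under eq_integral do rewrite EFinM.
  rewrite integralZl//.
  over.
have igfin : \int[m2]_y (g y)%:E \is a fin_num by exact: integrable_fin_num.
by rewrite /= -(fineK igfin) integralZr.
Qed.

(** Pythagoras' theorem in L^2; on centred variables it is Bienayme's formula
    for the variance of a sum. *)
Lemma expectation_sqr_sum (I : finType) (Z : I -> T -> R) :
  (forall i, Z i \in Lfun P 2%:E) ->
  (forall i j, i != j -> 'E_P[(Z i \* Z j)%R] = 0) ->
  'E_P[fun w => ((\sum_i Z i w) ^+ 2)%R] =
  \sum_i 'E_P[fun w => (Z i w ^+ 2)%R].
Proof.
move=> Z2 Z0; rewrite unlock.
under eq_integral.
  move=> w _.
  rewrite expr2 mulr_suml -sumEFin.
  under eq_bigr do rewrite mulr_sumr -sumEFin.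
  over.
have int2 i j : P.-integrable setT (EFin \o (Z i \* Z j)%R).
  exact/Lfun1_integrable/Lfun2_mul_Lfun1.
rewrite /= integral_sum//; last first.
  by move=> i; apply: integrable_sum => // j _; exact: int2.
apply: eq_bigr => i _; rewrite integral_sum//; last by move=> j; exact: int2.
rewrite (bigD1 i)//= big1 ?adde0 => [|j ji].
  by under eq_integral do rewrite -expr2.
by have := Z0 i j; rewrite unlock; apply; rewrite eq_sym.
Qed.

End independence.

(** * Mean square error of the bootstrap means *)

Section bootstrap_error.
Local Open Scope ereal_scope.
Context {d : measure_display} {T : measurableType d} {R : realType}.
Variable P : probability T R.

Lemma mutually_independent_pair (I : finType) (X : I -> {RV P >-> R}) (i j : I)
    (A B : set R) : mutually_independent X -> i != j ->
  measurable A -> measurable B ->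
  P (X i @^-1` A `&` X j @^-1` B) = P (X i @^-1` A) * P (X j @^-1` B).
Proof.
move=> indX ij mA mB.
pose C k := if k == i then A else B.
have mC k : k \in [set i; j]%SET -> measurable (C k) by rewrite /C; case: ifP.
have := indX [set i; j]%SET C mC.
rewrite big_setU1 ?inE//= big_set1 /C eqxx eq_sym (negbTE ij) => <-.
congr (P _); apply/seteqP; split => w /=.
  move=> [Aw Bw] k /=; rewrite !inE => /orP[] /eqP ->; first by rewrite eqxx.
  by rewrite eq_sym (negbTE ij).
move=> inC; split.
  by have := inC i; rewrite /= !inE !eqxx; apply.
by have := inC j; rewrite /= !inE eqxx orbT eq_sym (negbTE ij); apply.
Qed.

Lemma bootstrap_mean_square_error (L W : nat) (ns : 'I_L -> R) (c dVC s : R)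
    (r : 'I_W -> 'I_L -> {RV P >-> R}) (l : 'I_L) :
  (0 < s)%R -> (0 < W)%N -> gaussian_bootstrap ns c dVC s r ->
  'E_P[fun w => ((xi_hat r w 0 l - phi c dVC (ns l)) ^+ 2)%R] <=
  (4 * Num.sqrt 2 * s ^+ 2 / W%:R)%R%:E.
Proof.
move=> s0 W0 [indr normr].
have WR0 : (0 < W%:R :> R)%R by rewrite ltr0n.
set m := phi c dVC (ns l).
pose Z i w := (r i l w - m)%R.
have Z2 i : Z i \in Lfun P 2%:E := normal_rv_Lfun2 s0 (normr i l).
have Z0 i j : i != j -> 'E_P[(Z i \* Z j)%R] = 0.
  move=> ij; pose f x : R := (x - m)%R.
  have mf : measurable_fun [set: R] f by exact: measurable_funB.
  rewrite (independent_expectationM (X := r i l) (Y := r j l)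
    (f := f) (g := f))//.
  - by rewrite (normal_rv_mean s0 (normr i l)) mul0e.
  - move=> A B; apply: (mutually_independent_pair (i := (i, l)) (j := (j, l))
      indr).
    by apply: contra ij => /eqP[->].
  - exact: Z2.
  - exact: Z2.
have -> : (fun w => ((xi_hat r w 0 l - m) ^+ 2)%R) =
    (W%:R ^- 2 \o* (fun w => (\sum_i Z i w) ^+ 2))%R.
  apply/funext => w /=; rewrite mxE sumrB sumr_const card_ord -mulr_natl.
  by field; rewrite gt_eqF.
rewrite expectationZl; last first.
  have -> : (fun w => ((\sum_i Z i w) ^+ 2)%R) = ((\sum_i Z i) \* (\sum_i Z i))%R.
    by apply/funext => w /=; rewrite fct_sumE expr2.
  have sumZ2 : (\sum_i Z i)%R \in Lfun P 2%:E.
    by rewrite rpred_sum ?lee1n//= => i _; exact: Z2.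
  exact: Lfun2_mul_Lfun1.
rewrite (expectation_sqr_sum Z2 Z0).
apply: (@le_trans _ _
    ((W%:R ^- 2)%:E * \sum_(i < W) (4 * Num.sqrt 2 * s ^+ 2)%R%:E)).
  rewrite lee_wpmul2l ?lee_fin ?invr_ge0 ?sqr_ge0//.
  by apply: lee_sum => i _; exact: normal_rv_second_moment s0 (normr i l).
rewrite sumEFin -EFinM lee_fin sumr_const card_ord -[X in (_ * X)%R]mulr_natl.
rewrite le_eqVlt; apply/orP; left; apply/eqP; field.
by rewrite gt_eqF.
Qed.

End bootstrap_error.

(** * Measurability of the deviation event *)

Section regression_function.
Context {R : realType}.
Implicit Types (c d x : R).

Lemma continuous_phi c x d : 0 < x -> 0 < d ->
  {for d, continuous (fun t => phi c t x)}.
Proof.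
move=> x0 d0; rewrite /phi.
have cvg_inner : 2 * x * expR 1 / t @[t --> d] --> 2 * x * expR 1 / d.
  apply: cvgM; first exact: cvg_cst.
  by apply: cvgV; [rewrite gt_eqF|exact: cvg_id].
have cvg_ln : ln (2 * x * expR 1 / t) @[t --> d] --> ln (2 * x * expR 1 / d).
  apply: (cvg_comp _ _ cvg_inner).
  by apply: continuous_ln; rewrite divr_gt0// !mulr_gt0// expR_gt0.
have cvg_rad : t / x * ln (2 * x * expR 1 / t) @[t --> d] -->
    d / x * ln (2 * x * expR 1 / d).
  by apply: cvgM => //; apply: cvgM; [exact: cvg_id|exact: cvg_cst].
apply: cvgM; first exact: cvg_cst.
by apply: (cvg_comp _ _ cvg_rad); exact: sqrt_continuous.
Qed.

Lemma continuous_sq_loss (L : nat) (ns : 'I_L -> R) c (xi : 'rV[R]_L) d :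
  (forall l, 0 < ns l) -> 0 < d -> {for d, continuous (sq_loss ns c xi)}.
Proof.
move=> ns0 d0; rewrite /sq_loss /continuous_at.
apply: (cvg_big (op := +%R)) => [|l _]; first exact: add_continuous.
apply: (@cvg_comp _ _ _ (fun t => xi 0 l - phi c t (ns l)) (fun y => y ^+ 2));
  last exact: sqr_continuous.
by apply: (@cvgB _ R^o); [exact: cvg_cst|exact: continuous_phi].
Qed.

(** The dimension set is open on the left, so every dimension, including the
    right endpoint, is a limit of rational dimensions smaller than it. *)
Lemma le_rational_dimensions (M : nat) (f : R -> R) (v : R) :
  (forall d, 0 < d -> {for d, continuous f}) ->
  (forall q : rat, dimension_set M (ratr q : R) -> v <= f (ratr q)) ->
  forall d, dimension_set M d -> v <= f d.
Proof.
move=> cf fq d; rewrite /dimension_set/= in_itv/= => /andP[d1 dM].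
rewrite leNgt; apply/negP => fdv.
have /cvgr_lt/(_ v fdv) := cf d (lt_trans ltr01 d1).
move=> /nbhs_ballP[e /= e0 ball_lt].
have [|q] := @rat_in_itvoo R (Num.max 1 (d - e)) d.
  by rewrite gt_max d1/= gtrBl.
rewrite in_itv/= gt_max => /andP[/andP[q1 qe] qd].
have := ball_lt (ratr q); rewrite /ball/= ltr_norml.
have -> : - e < d - ratr q < e by apply/andP; split; lra.
move=> /(_ isT); apply/negP; rewrite -leNgt; apply: fq.
by rewrite /dimension_set/= in_itv/= q1 (le_trans (ltW qd)).
Qed.

Lemma measurable_phi c x : 0 < x ->
  measurable_fun (`]0, +oo[ : set R) (fun d => phi c d x).
Proof.
move=> x0; apply: open_continuous_measurable_fun; first exact: rray_open.
by move=> d; rewrite inE/= in_itv/= andbT => d0; exact: continuous_phi.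
Qed.

End regression_function.

Section deviation_event.
Context {R : realType} {disp : measure_display} {T : measurableType disp}.
Variable P : probability T R.
Variables (L W : nat) (ns : 'I_L -> R) (M : nat) (c dVC : R).
Variables (r : 'I_W -> 'I_L -> {RV P >-> R}) (dhat : {RV P >-> R}).
Hypothesis ns0 : forall l, 0 < ns l.

Let D := dhat @^-1` (dimension_set M).

Let mD : measurable D.
Proof. by apply: measurable_funPTI; exact: measurable_itv. Qed.

Let mphi l : measurable_fun D (fun w => phi c (dhat w) (ns l)).
Proof.
apply: (@measurable_comp _ _ _ _ _ _ (`]0, +oo[%classic : set R)
  (fun d => phi c d (ns l))) => //.
- move=> _ [w Dw <-]; move: Dw.
  rewrite /D /dimension_set/= !in_itv/= andbT => /andP[+ _]; exact: lt_trans.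
- exact: measurable_phi.
- exact: measurable_funTS.
Qed.

Let mxi l : measurable_fun D (fun w => xi_hat r w 0 l).
Proof.
under eq_fun do rewrite mxE.
apply: measurable_funM => //; apply: measurable_sum => i.
exact: measurable_funTS.
Qed.

Let h w := normL (phi_vec ns c (dhat w) - phi_vec ns c dVC).

Let mh : measurable_fun D h.
Proof.
apply: (@measurableT_comp _ _ _ _ _ _ (@Num.sqrt R)).
  by apply: continuous_measurable_fun; exact: sqrt_continuous.
rewrite /inner; apply: measurable_funM => //.
apply: measurable_sum => l; under eq_fun do rewrite !mxE.
by apply: measurable_funM; apply: measurable_funB => //; exact: mphi.
Qed.

Let mloss (d : T -> R) :
  (forall l, measurable_fun D (fun w => phi c (d w) (ns l))) ->
  measurable_fun D (fun w => sq_loss ns c (xi_hat r w) (d w)).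
Proof.
move=> md; apply: measurable_sum => l.
by apply: measurable_funX; apply: measurable_funB; [exact: mxi|exact: md].
Qed.

(** On the event that dhat is an admissible dimension, where phi is continuous in
    it, the losses are measurable; minimality is tested on rational competitors
    only, which leaves a countable intersection. *)
Lemma measurable_deviation_event rad delta :
  measurable (deviation_event ns M c dVC rad delta r dhat).
Proof.
rewrite (_ : deviation_event _ _ _ _ _ _ _ _ =
  (\bigcap_(q : rat) (D `&` [set w | dimension_set M (ratr q : R) ->
     sq_loss ns c (xi_hat r w) (dhat w) <=
     sq_loss ns c (xi_hat r w) (ratr q)])) `&`
  ((D `&` [set w | h w < rad]) `&` (D `&` [set w | delta <= h w]))); last first.
  apply/seteqP; split => w /=.
    move=> [[Dw minw] [_ hrad] hdelta]; split; last by do !split.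
    by move=> q _; split => //=; exact: minw.
  move=> [minw [[Dw hrad] [_ hdelta]]]; split => //.
  - split => // d' d'M; apply: (le_rational_dimensions (M := M)) d'M => //.
      by move=> d d0; exact: continuous_sq_loss.
    by move=> q qM; have [_ /(_ qM)] := minw q I.
  - by split => //; exists (dhat w).
apply: measurableI; last first.
  apply: measurableI; last exact: measurable_fun_le.
  have -> : [set w | h w < rad] = h @^-1` `]-oo, rad[.
    by apply/seteqP; split => w; rewrite /= in_itv.
  by apply: mh => //; exact: measurable_itv.
rewrite -[X in measurable X]setCK setC_bigcap; apply: measurableC.
apply: bigcupT_measurable_rat => q; apply: measurableC.
have [qM|qM] := pselect (dimension_set M (ratr q : R)); last first.
  rewrite (_ : _ `&` _ = D)//; apply/seteqP; split => [w []//|w Dw].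
  by split.
rewrite (_ : _ `&` _ = D `&` [set w | sq_loss ns c (xi_hat r w) (dhat w) <=
     sq_loss ns c (xi_hat r w) (ratr q)]); last first.
  by apply/seteqP; split => w [Dw minw]; split => //; exact: minw.
apply: measurable_fun_le => //; first exact: mloss.
by apply: (mloss (d := fun=> ratr q)).
Qed.

End deviation_event.

(** * Deviation of the least squares estimator *)

Section consistency.
Context {R : realType} {disp : measure_display} {T : measurableType disp}.
Variable P : probability T R.
Variables (L W : nat) (ns : 'I_L -> R) (M : nat) (c dVC : R).

Lemma sqr_normL (f : 'rV[R]_L) :
  normL f ^+ 2 = L%:R^-1 * \sum_(l < L) f 0 l ^+ 2.
Proof.
rewrite /normL /inner sqr_sqrtr; first by under eq_bigr do rewrite -expr2.
by rewrite mulr_ge0// ?invr_ge0// sumr_ge0// => l _; rewrite -expr2 sqr_ge0.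
Qed.

(** The basic inequality of least squares. With h = phi_d - phi0 and
    eps = xi - phi0, minimality reads sum (eps - h)^2 <= sum eps^2, that is
    sum h^2 <= 2 sum eps h, and 2 eps h <= 2 eps^2 + h^2 / 2. *)
Lemma minimizer_error (xi : 'rV[R]_L) d :
  dimension_set M dVC -> minimizers ns M c xi d ->
  normL (phi_vec ns c d - phi_vec ns c dVC) ^+ 2 <=
  4 * normL (xi - phi_vec ns c dVC) ^+ 2.
Proof.
move=> dM [_ /(_ _ dM)]; rewrite /sq_loss => le_loss.
rewrite !sqr_normL mulrCA ler_wpM2l ?invr_ge0// mulr_sumr.
(* the difference of the two sides is sum (h - 2 eps)^2 / 2 *)
have : \sum_(l < L) (phi_vec ns c d - phi_vec ns c dVC) 0 l ^+ 2 / 2 <=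
   \sum_(l < L)
     ((xi 0 l - phi c d (ns l)) ^+ 2 - (xi 0 l - phi c dVC (ns l)) ^+ 2 +
      2 * (xi - phi_vec ns c dVC) 0 l ^+ 2).
  apply: ler_sum => l _; rewrite !mxE -subr_ge0.
  set x := xi 0 l; set p := phi c d _; set q := phi c dVC _.
  have -> : (x - p) ^+ 2 - (x - q) ^+ 2 + 2 * (x - q) ^+ 2 - (p - q) ^+ 2 / 2 =
     2^-1 * ((p - q) - 2 * (x - q)) ^+ 2 by field.
  by rewrite mulr_ge0// sqr_ge0.
rewrite !big_split/= sumrN -!mulr_suml -!mulr_sumr => half_le.
by have := lerD half_le le_loss; lra.
Qed.

Variables (r : 'I_W -> 'I_L -> {RV P >-> R}) (dhat : {RV P >-> R}).

(** Markov's inequality for |eps|^2: on the event,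
    1 <= (4 / delta^2) |eps|^2 = k * sum_l eps_l^2 with k = 4 / (delta^2 L). *)
Lemma deviation_probability (rad s delta : R) :
  0 < s -> 0 < delta -> (0 < L)%N -> (0 < W)%N -> (forall l, 0 < ns l) ->
  dimension_set M dVC -> gaussian_bootstrap ns c dVC s r ->
  (P (deviation_event ns M c dVC rad delta r dhat) <=
   (16 * Num.sqrt 2 * s ^+ 2 / delta ^+ 2 / W%:R)%:E)%E.
Proof.
move=> s0 delta0 L0 W0 ns0 dM gr.
have LR0 : 0 < L%:R :> R by rewrite ltr0n.
have WR0 : 0 < W%:R :> R by rewrite ltr0n.
set D := deviation_event _ _ _ _ _ _ _ _.
have mD : measurable D by exact: measurable_deviation_event.
pose K := 4 * Num.sqrt 2 * s ^+ 2 / W%:R.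
pose e l w := (xi_hat r w 0 l - phi c dVC (ns l)) ^+ 2.
pose k : R := 4 / (delta ^+ 2 * L%:R).
have k0 : 0 <= k by rewrite divr_ge0// mulr_ge0// ?sqr_ge0.
have me l : measurable_fun [set: T] (e l).
  apply: measurable_funX; apply: measurable_funB => //.
  under eq_fun do rewrite mxE.
  by apply: measurable_funM => //; apply: measurable_sum => i.
rewrite -[D]setIT -integral_indic//.
apply: (@le_trans _ _ (\int[P]_w (k%:E * \sum_(l < L) (e l w)%:E))%E).
  apply: ge0_le_integral => //.
  - by apply/measurable_EFinP; exact: measurable_indic.
  - apply: emeasurable_funM => //; apply: emeasurable_sum => l.
    exact/measurable_EFinP.
  - move=> w _; rewrite sumEFin -EFinM lee_fin indicE.
    have [|_] := boolP (w \in D); last first.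
      by rewrite mulr_ge0// sumr_ge0// => l _; rewrite sqr_ge0.
    rewrite inE => -[minw _ hdelta].
    have delta_sqr :
        delta ^+ 2 <= normL (phi_vec ns c (dhat w) - phi_vec ns c dVC) ^+ 2.
      by rewrite ler_sqr ?nnegrE ?sqrtr_ge0// ltW.
    have := le_trans delta_sqr (minimizer_error dM minw).
    rewrite sqr_normL (eq_bigr (e ^~ w)); last by move=> l _; rewrite /e !mxE.
    move=> le_error; rewrite /k mulrAC ler_pdivlMr ?mulr_gt0 ?exprn_gt0// mul1r.
    rewrite -ler_pdivlMr// (le_trans le_error)//.
    by rewrite le_eqVlt; apply/orP; left; apply/eqP; field; rewrite gt_eqF.
rewrite ge0_integralZl//; last 2 first.
- apply: emeasurable_sum => l; exact/measurable_EFinP.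
- by move=> w _; apply: sume_ge0 => l _; rewrite lee_fin sqr_ge0.
rewrite ge0_integral_sum//; last 2 first.
- by move=> l; exact/measurable_EFinP.
- by move=> l w _; rewrite lee_fin sqr_ge0.
apply: (@le_trans _ _ (k%:E * \sum_(l < L) K%:E)%E).
  rewrite lee_wpmul2l ?lee_fin//; apply: lee_sum => l _.
  by have := bootstrap_mean_square_error l s0 W0 gr; rewrite unlock.
rewrite sumEFin -EFinM lee_fin sumr_const card_ord -[X in _ * X]mulr_natl.
rewrite le_eqVlt; apply/orP; left; apply/eqP; rewrite /k /K; field.
by rewrite !gt_eqF.
Qed.

End consistency.

Theorem theorem5 (R : realType) (rad sigma delta : R)
    (sigma_gt0 : 0 < sigma) (delta_gt0 : 0 < delta) :
  exists C : R,
  forall (M L : nat) (a b c dVC : R) (ns : 'I_L -> R)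
    (W : nat -> nat)
    (disp : nat -> nat -> measure_display)
    (T : forall n m, measurableType (disp n m))
    (P : forall n m, probability (T n m) R)
    (r : forall n m, 'I_(W n) -> 'I_L -> {RV (P n m) >-> R})
    (dhat : forall n m, {RV (P n m) >-> R}),
  (0 < L)%N ->
  (forall l, 0 < ns l) ->
  c \in `[a, b] ->
  dimension_set M dVC ->
  sup [set normL (phi_vec ns c d) | d in dimension_set M] < rad ->
  W @ \oo --> \oo ->
  (forall n m, gaussian_bootstrap ns c dVC sigma (@r n m)) ->
  (forall n m, least_squares_estimator ns M c (@r n m) (dhat n m)) ->
  \forall n \near \oo & m \near \oo,
    (P n m (deviation_event ns M c dVC rad delta (@r n m) (dhat n m))
      <= (C / (W n)%:R)%:E)%E.
Proof.
exists (16 * Num.sqrt 2 * sigma ^+ 2 / delta ^+ 2).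
move=> M L a b c dVC ns W disp T P r dhat L0 ns0 _ dM _ Woo gr _.
have W0 : \forall n \near \oo, (0 < W n)%N by exact: (Woo _ (nbhs_infty_gt 0)).
exists ([set n | (0 < W n)%N], setT); first by split => //; exact: filterT.
by move=> [n m] [/= Wn_gt0 _]; exact: deviation_probability.
Qed.
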